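(* Let $u$ be a bounded convex function on $\overline{\Omega}$ and, for each (small) $h>0$, let $u_h$ be a mesh function on $\mathcal{N}_h$. Let $R$ be a locally integrable function on $\mathbb{R}^d$ with $R>0$ on $\partial u(\Omega)$ and $R=0$ on $\mathbb{R}^d\setminus\partial u(\Omega)$. If $u_h$ converges to $u$ uniformly on $\overline{\Omega}$, then $\omega(R,u_h,\cdot)$ weakly converges to $\omega(R,u,\cdot)$.
   Context: $\Omega\subset\mathbb{R}^d$ is a nonempty bounded convex domain (open) with boundary $\partial\Omega$. For $h>0$: $\mathbb{Z}^d_h=\{mh: m\in\mathbb{Z}^d\}$ and $\Omega_h=\Omega\cap\mathbb{Z}^d_h$; $h$ is always small enough that $\Omega_h\neq\emptyset$. $(r_1,\dots,r_d)$ is the canonical basis of $\mathbb{R}^d$. For $x\in\Omega_h$ and $e\in\mathbb{Z}^d$, $h^e_x=\sup\{rh: r\in[0,1],\ x+rhe\in\overline{\Omega}\}$. $V\subset\mathbb{Z}^d$ is a set of directions containing $r_1,\dots,r_d$, with $-e\in V$ whenever $e\in V$, and such that each $e\in V$ is the first element of some basis of $\mathbb{Z}^d$ (the choice $V=\mathbb{Z}^d\setminus\{0\}$ is also allowed). $\partial\Omega_h=\{x\in\partial\Omega: x=y+h^e_y e \text{ for some } y\in\Omega_h, e\in V\}$, $\mathcal{N}_h=\Omega_h\cup\partial\Omega_h$. A mesh function is a function $u_h:\mathcal{N}_h\to\mathbb{R}$. $u_h$ converges to $u$ uniformly on $\overline{\Omega}$ if for each sequence $h_k\to0$ and each $\epsilon>0$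 there is $h_{-1}>0$ such that for all $h_k$ with $0<h_k<h_{-1}$ one has $\max_{x\in\mathcal{N}_{h_k}}|u_{h_k}(x)-u(x)|<\epsilon$. For a convex function $u$ on $\Omega$ and $x_0\in\Omega$, $\partial u(x_0)=\{p\in\mathbb{R}^d: u(x)\ge u(x_0)+p\cdot(x-x_0)\ \forall x\in\Omega\}$, $\partial u(E)=\bigcup_{x\in E}\partial u(x)$, and $\omega(R,u,E)=\int_{\partial u(E)}R(p)\,dp$ for Borel $E\subset\Omega$. For a mesh function $u_h$ and $x\in\Omega_h$, $\partial_h u_h(x)=\{p\in\mathbb{R}^d: u_h(y)\ge u_h(x)+p\cdot(y-x)\ \forall y\in\mathcal{N}_h\}$ (possibly empty), $\partial_h u_h(E)=\bigcup_{x\in E\cap\mathbb{Z}^d_h}\partial_h u_h(x)$, and $\omega(R,u_h,E)=\int_{\partial_h u_h(E)}R(p)\,dp$ for $E\subset\Omega$. Weak convergence: a sequence of Borel measures $\mu_n$ converges weakly to a Borel measure $\mu$ if and only if $\mu_n(B)\to\mu(B)$ for any Borel set $B\subset\Omega$ with $\mu(\partial B)=0$; for the family indexed by $h$ this is required along every sequence $h_k\to0$.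
   Formalization: The boundary mass of B is taken as the mass of Ω∩∂B; if ω(R,u,Ω) is infinite and ω(R,u,B) finite, ∂B must lie inside Ω, since otherwise ω(R,u,∂B) is undefined and the extended claim fails (e.g. u=-2√x on (0,1)). *)

(* Defs.v *)
From HB Require Import structures.
From mathcomp Require Import all_boot all_order all_algebra.
From mathcomp Require Import all_classical all_reals all_analysis.

Set Implicit Arguments.
Unset Strict Implicit.
Unset Printing Implicit Defensive.

Import Order.TTheory GRing.Theory Num.Theory.
Import numFieldNormedType.Exports.

Local Open Scope classical_set_scope.
Local Open Scope ring_scope.

(* The ambient space, of dimension at least 1, is 'rV[R]_d.+1; the topology of its
   sup norm is the Euclidean one. *)

Definition frontier (T : topologicalType) (A : set T) : set T :=
  closure A `\` interior A.

Definition borel (T : topologicalType) : set (set T) := <<s [set U | open U] >>.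

(* Lebesgue measure on 'rV[R]_d.+1: Lebesgue outer measure (countable covers by
   half-open boxes) restricted to its Caratheodory-measurable sets. *)
Section lebesgue_measure_rV.
Context {R : realType} {d : nat}.
Local Notation E := 'rV[R]_d.+1.
Local Open Scope ereal_scope.
Implicit Types (A : set E) (F : nat -> E * E).

Definition box (ab : E * E) : set E :=
  [set x : E | forall i, (ab.1 0 i < x 0 i <= ab.2 0 i)%R].

Definition box_volume (ab : E * E) : \bar R :=
  (\prod_i Num.max 0 (ab.2 0 i - ab.1 0 i)%R)%:E.

Definition lebesgue_outer A : \bar R :=
  ereal_inf [set \sum_(k <oo) box_volume (F k) |
             F in [set F | A `<=` \bigcup_k box (F k)]].

Lemma box_volume_ge0 ab : 0 <= box_volume ab.
Proof. by rewrite lee_fin; apply: prodr_ge0 => i _; rewrite le_max lexx. Qed.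

Lemma lebesgue_outer_ge0 A : 0 <= lebesgue_outer A.
Proof.
apply: le_ereal_inf_tmp => _ [F _ <-].
by apply: nneseries_ge0 => n _ _; exact: box_volume_ge0.
Qed.

Lemma le_lebesgue_outer : {homo lebesgue_outer : A B / A `<=` B >-> A <= B}.
Proof.
move=> A B AB; apply/ereal_inf_le_tmp => _ [F BF <-].
by exists F => //; exact: subset_trans AB BF.
Qed.

Lemma lebesgue_outer0 : lebesgue_outer set0 = 0.
Proof.
apply/eqP; rewrite eq_le lebesgue_outer_ge0 andbT.
apply: ereal_inf_lbound; exists (fun=> (0, 0)%R) => //.
apply: eseries0 => n _ _; rewrite /box_volume big_ord_recl /=.
by rewrite subrr maxxx mul0r.
Qed.

Lemma lebesgue_outer_sigma_subadditive : sigma_subadditive lebesgue_outer.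
Proof.
move=> A; have [[i ioo]|] := pselect (exists i, lebesgue_outer (A i) = +oo).
  rewrite (eseries_pinfty _ _ ioo) ?leey// => n _.
  by rewrite -ltNye (lt_le_trans _ (lebesgue_outer_ge0 _)).
rewrite -forallNE => Aoo.
suff add2e (e : {posnum R}) :
    lebesgue_outer (\bigcup_n A n) <=
    \sum_(i <oo) lebesgue_outer (A i) + e%:num%:E.
  by apply/lee_addgt0Pr => _/posnumP[].
rewrite (le_trans _ (epsilon_trick _ _ _))//; last first.
  by move=> n; exact: lebesgue_outer_ge0.
pose P n F := A n `<=` \bigcup_k box (F k) /\
  \sum_(k <oo) box_volume (F k) <=
  lebesgue_outer (A n) + (e%:num / (2 ^ n.+1)%:R)%:E.
have [G PG] : {G : nat -> nat -> E * E & forall n, P n (G n)}.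
  apply: (@choice _ _ P) => n; rewrite /P /lebesgue_outer.
  set S := (X in ereal_inf X); move infS : (ereal_inf S) => iS.
  case: iS infS => [r Sr|Soo|Soo].
  - have en1 : (0 < e%:num / (2 ^ n.+1)%:R)%R by [].
    have /(lb_ereal_inf_adherent en1) : ereal_inf S \is a fin_num by rewrite Sr.
    move=> [x [F AF volx] xS].
    by exists F; split => //; rewrite volx -Sr; exact/ltW.
  - by have := Aoo n; rewrite /lebesgue_outer Soo.
  - by have := lebesgue_outer_ge0 (A n); rewrite /lebesgue_outer Soo.
have G_ge0 x : 0 <= (box_volume \o uncurry G) x by exact: box_volume_ge0.
apply: (@le_trans _ _ (\esum_(i in setT) (box_volume \o uncurry G) i)).
  apply: ereal_inf_lbound => /=.
  have /card_esym/ppcard_eqP[f] := card_nat2.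
  exists (uncurry G \o f).
    move=> t [i _] /(PG i).1 [j _ Gt]; exists (f^-1%FUN (i, j)) => //=.
    by rewrite invK ?inE.
  rewrite -(esum_pred_image (box_volume \o uncurry G) _ xpredT) ?[fun=> _]set_true//.
  by rewrite image_eq.
rewrite (_ : esum _ _ = \sum_(i <oo) \sum_(j <oo ) box_volume (G i j)); last first.
  pose J : nat -> set (nat * nat) := fun i => [set (i, j) | j in setT].
  rewrite (_ : setT = \bigcup_k J k); last first.
    by rewrite predeqE => -[a b]; split => // _; exists a => //; exists b.
  rewrite esum_bigcupT /=; last 2 first.
    - apply/trivIsetP => i j _ _ ij.
      rewrite predeqE => -[n m] /=; split => //= -[] [_] _ [<-{n} _].
      by move=> [m' _] [] /esym/eqP; rewrite (negbTE ij).
    - by move=> /= [n m]; exact: box_volume_ge0.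
  rewrite -(image_id [set: nat]) -fun_true esum_pred_image//; last first.
    by move=> n _; apply: esum_ge0 => *; exact: box_volume_ge0.
  apply: eq_eseriesr => /= j _.
  rewrite -(esum_pred_image (box_volume \o uncurry G) (pair j) predT)//=; last 2 first.
  - by move=> n _; exact: box_volume_ge0.
  - by move=> ? ? _ _; exact: (@can_inj _ _ _ snd).
  by congr esum; rewrite predeqE => -[a b]; split; move=> [i _ <-]; exists i.
apply: lee_lim.
- apply: is_cvg_nneseries => n *.
  by apply: nneseries_ge0 => m *; exact: (G_ge0 (n, m)).
- by apply: is_cvg_nneseries => n *; apply: adde_ge0 => //; exact: lebesgue_outer_ge0.
- by near=> n; apply: lee_sum => i _; exact: (PG i).2.
Unshelve. all: by end_near. Qed.

HB.instance Definition _ := isOuterMeasure.Build R E lebesgue_outer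
  lebesgue_outer0 lebesgue_outer_ge0 le_lebesgue_outer
  lebesgue_outer_sigma_subadditive.

Let lebesgue_outer_measure : {outer_measure set E -> \bar R} := lebesgue_outer.

Definition lebesgue_rV := caratheodory_type lebesgue_outer_measure.

HB.instance Definition _ := Measurable.on lebesgue_rV.

Definition lebesgue_measure_rV : set lebesgue_rV -> \bar R := lebesgue_outer.

HB.instance Definition _ := Measure.copy lebesgue_measure_rV
  (lebesgue_outer_measure : set lebesgue_rV -> \bar R).

Definition locally_integrable_rV (f : E -> R) : Prop :=
  measurable_fun [set: lebesgue_rV] (f : lebesgue_rV -> R) /\
  forall K : set E, compact K ->
    \int[lebesgue_measure_rV]_(p in K) (`|f p|%R)%:E < +oo.

End lebesgue_measure_rV.

Section mesh.
Context {R : realType} {d : nat}.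
Local Notation E := 'rV[R]_d.+1.
Implicit Types (Om : set E) (V : set 'rV[int]_d.+1) (h : R).

Definition dotv (p x : E) : R := \sum_i p 0 i * x 0 i.

Definition of_int (e : 'rV[int]_d.+1) : E := map_mx intr e.

Definition is_Zbasis (b : 'I_d.+1 -> 'rV[int]_d.+1) : Prop :=
  forall z : 'rV[int]_d.+1,
    exists! c : 'rV[int]_d.+1, z = \sum_i c 0 i *: b i.

Definition direction_set V : Prop :=
  [/\ forall i, V (delta_mx 0 i),
      forall e, V e -> V (- e) &
      (forall e, V e -> exists2 b, is_Zbasis b & b 0 = e) \/
      V = [set e | e != 0] ].

Definition lattice h : set E := [set h *: of_int m | m in [set: 'rV[int]_d.+1]].

Definition mesh_interior Om h : set E := Om `&` lattice h.

Definition mesh_step Om h (x : E) (e : 'rV[int]_d.+1) : R :=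
  sup [set r * h | r in
       [set r : R | 0 <= r <= 1 /\ closure Om (x + (r * h) *: of_int e)]].

Definition mesh_boundary Om V h : set E :=
  [set x | frontier Om x /\
    exists y e, [/\ mesh_interior Om h y, V e &
                    x = y + mesh_step Om h y e *: of_int e] ].

Definition mesh Om V h : set E := mesh_interior Om h `|` mesh_boundary Om V h.

(* Mesh functions are total functions of which only the values on the mesh are
   used; v h is the mesh function attached to h.  The mesh may be infinite (when
   V is), so the bound on the maximum is stated pointwise. *)
Definition mesh_uniform_cvg Om V (v : R -> E -> R) (u : E -> R) : Prop :=
  forall hs : nat -> R, hs @ \oo --> (0 : R) ->
  forall eps : R, 0 < eps ->
  exists2 h1 : R, 0 < h1 &
    forall k, 0 < hs k < h1 ->
    forall x, mesh Om V (hs k) x -> `|v (hs k) x - u x| < eps.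

Definition subdifferential Om (u : E -> R) (x0 : E) : set E :=
  [set p | forall x, Om x -> u x0 + dotv p (x - x0) <= u x].

Definition omega Om (rho : E -> R) (u : E -> R) (A : set E) : \bar R :=
  (\int[lebesgue_measure_rV]_(p in \bigcup_(x in A) subdifferential Om u x)
    (rho p)%:E)%E.

Definition mesh_subdifferential Om V h (v : E -> R) (x : E) : set E :=
  [set p | forall y, mesh Om V h y -> v x + dotv p (y - x) <= v y].

Definition mesh_omega Om V h (rho : E -> R) (v : E -> R) (A : set E) : \bar R :=
  (\int[lebesgue_measure_rV]_(p in
      \bigcup_(x in A `&` lattice h) mesh_subdifferential Om V h v x)
    (rho p)%:E)%E.

(* mu is a set function on subsets of Om, so mu (frontier B) literally makes sense
   only when frontier B is included in Om (equivalently, when the closure of B is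
   included in Om).  Such B are always allowed.  Any other B is allowed as well,
   its boundary being measured inside Om, except when B has finite mass while Om
   has infinite mass: uniform convergence gives no control on those.  E.g., take
   Om = ]0, 1[, u x = - 2 * sqrt x, rho the indicator of ]-oo, -1[, and B a union
   of small neighborhoods of the points 4^-m with finite mass.  Replacing u on
   [4^-(n+1), 4^-(n-1)] by its affine interpolation at 4^-(n+1), 4^-n, 4^-(n-1)
   changes u by O(2^-n) but puts a mass (2/3) * 2^n at 4^-n, hence in B. *)
Definition weak_cvg Om (mu_ : R -> set E -> \bar R) (mu : set E -> \bar R) :
    Prop :=
  forall hs : nat -> R, (forall k, 0 < hs k) -> hs @ \oo --> (0 : R) ->
  forall B : set E, borel B -> B `<=` Om ->
    (mu Om = +oo%E -> (mu B < +oo)%E -> frontier B `<=` Om) ->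
    mu (Om `&` frontier B) = 0%E ->
    mu_ (hs k) B @[k --> \oo] --> mu B.

End mesh.

(* Main.v *)
Require Import Defs.
From HB Require Import structures.
From mathcomp Require Import all_boot all_order all_algebra.
From mathcomp Require Import all_classical all_reals all_analysis.
From mathcomp Require Import measurable_realfun ring lra zify.

(** The theorem is an almost everywhere statement about slopes rather than one
about measures.  Write D_k for the union of the discrete subdifferentials of
u_(h_k) over B, and D for the union of the subdifferentials of u over B.  Both
masses are integrals of the same function rho, over D_k and over D, and rho
vanishes outside of the slopes of u over Om.  It therefore suffices to show that
the indicator of D_k converges to that of D at almost every slope p of u, and to
pass to the limit under the integral sign.

Almost every p belongs to the subdifferential of u at no more than one point
([nonunique_subgradients_null]).  By monotonicity of the subdifferential, the
slopes p with contact points x and y such that x_i <= a < b <= y_i, x and y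
ranging over compact sets, form a closed set which meets every line parallel to
the i-th axis in at most one point; its translates along this axis are pairwise
disjoint, so that it is null ([closed_line_null]).  Countably many such sets
cover the slopes with several contact points.

If p has the single contact point x, then u exceeds its supporting plane at x by
a fixed amount outside of every ball around x, even up to the boundary
([unique_subgradient_growth]).  Hence, as soon as u_h is close to u on the mesh
and the mesh is fine, the contact points of p with u_h exist and all lie near x
([discrete_subgradient_cvg]).  If x is interior to B, then p is in D and
eventually in D_k; if x is outside of the closure of B, it is in neither.  The
remaining slopes have their contact point on the frontier of B; they form a
measurable set of zero mass, on which rho is positive, hence a null set.

For the integrals, rho itself is a dominating function if the mass of Om is
finite.  If the mass of B is infinite, Fatou's lemma suffices.  In the remaining
case the closure of B is a compact subset of Om; difference quotients over a
fixed distance then bound all the D_k at once ([mesh_subdifferential_bounded]),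
and rho is dominated by its restriction to a cube. *)

Set Implicit Arguments.
Unset Strict Implicit.
Unset Printing Implicit Defensive.

Import Order.TTheory GRing.Theory Num.Theory.
Import numFieldNormedType.Exports.

Local Open Scope classical_set_scope.
Local Open Scope ring_scope.

(** * Measurable sets and null sets of the Lebesgue measure *)

Section lebesgue_sets.
Context {R : realType} {d : nat}.
Local Notation E := 'rV[R]_d.+1.
Local Notation mu := (@lebesgue_measure_rV R d).
Local Notation rV_measurable := (measurable : set (set (@lebesgue_rV R d))).

Lemma le_lebesgue_outer_shift (A : set E) (t : E) :
  (lebesgue_outer A <= lebesgue_outer [set x : E | A (x - t)%R])%E.
Proof.
apply: le_ereal_inf_tmp => _ [F AF <-]; apply: ereal_inf_lbound.
exists (fun k => ((F k).1 - t, (F k).2 - t)).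
  move=> x Ax; have [|k _ Fk] := AF (x + t); first by rewrite /= addrK.
  by exists k => // i; move: (Fk i); rewrite !mxE; lra.
apply: eq_eseriesr => k _; congr EFin; apply: eq_bigr => i _ /=.
by rewrite !mxE; congr Num.max; ring.
Qed.

(** A hyperplane orthogonal to an axis cuts a box into two boxes whose volumes
add up, so that every cover by boxes splits into covers of the two sides. *)
Lemma halfspace_measurable (i : 'I_d.+1) (a : R) :
  rV_measurable [set x : E | x 0 i <= a].
Proof.
apply: le_caratheodory_measurable => X; apply: le_ereal_inf_tmp => _ [F XF <-].
pose Fl k : E * E := ((F k).1,
  \row_j if j == i then Num.min ((F k).2 0 j) a else (F k).2 0 j).
pose Fr k : E * E :=
  (\row_j (if j == i then Num.max ((F k).1 0 j) a else (F k).1 0 j), (F k).2).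
have -> : (\sum_(k <oo) box_volume (F k) =
    \sum_(k <oo) box_volume (Fl k) + \sum_(k <oo) box_volume (Fr k))%E.
  rewrite -nneseriesD; try by move=> *; exact: box_volume_ge0.
  apply: eq_eseriesr => k _; rewrite /box_volume -EFinD; congr EFin.
  pose P := \prod_(j < d.+1 | j != i) Num.max 0 ((F k).2 0 j - (F k).1 0 j).
  have split_i (G : 'I_d.+1 -> R) :
      (forall j, j != i -> G j = Num.max 0 ((F k).2 0 j - (F k).1 0 j)) ->
      \prod_j G j = G i * P.
    by move=> GF; rewrite (bigD1 i)//=; congr (_ * _); exact: eq_bigr.
  rewrite !split_i //; last 2 first.
  - by move=> j /negbTE ji; rewrite !mxE ji.
  - by move=> j /negbTE ji; rewrite !mxE ji.
  rewrite -mulrDl !mxE eqxx; congr (_ * _).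
  set b := (F k).2 0 i; set c := (F k).1 0 i.
  case: (lerP b a) => ba; case: (lerP c a) => ca; rewrite !/Num.max;
  by repeat case: ifPn; rewrite -?leNgt; lra.
apply: leeD; apply: ereal_inf_lbound.
  exists Fl => // x [Xx xa]; have [k _ Fk] := XF _ Xx; exists k => // j.
  move: (Fk j); rewrite !mxE; case: ifPn => // /eqP ->.
  by move=> /andP[-> ?]; rewrite le_min xa andbT.
exists Fr => // x [Xx /negP]; rewrite -ltNge => xa; have [k _ Fk] := XF _ Xx; exists k => // j.
move: (Fk j); rewrite !mxE; case: ifPn => // /eqP ->.
by move=> /andP[? ->]; rewrite gt_max xa !andbT.
Qed.

Lemma box_measurable (ab : E * E) : rV_measurable (box ab).
Proof.
pose H i (a : R) := [set x : E | x 0 i <= a].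
have -> : box ab = \bigcap_(i in [set: 'I_d.+1]) (H i (ab.2 0 i) `\` H i (ab.1 0 i)).
  apply/seteqP; split => [x xab i _|x xab i].
    by have /andP[lt le] := xab i; split => //; apply/negP; rewrite -ltNge.
  by have [/= -> /negP] := xab i I; rewrite -ltNge andbT.
apply: fin_bigcap_measurable => // i _.
by apply: measurableD; exact: halfspace_measurable.
Qed.

(** An open set is the union of the countably many boxes with rational center and
side 2 / (n + 1) that it contains. *)
Lemma open_rV_measurable (U : set E) : open U -> rV_measurable U.
Proof.
move=> oU.
pose C (q : 'rV[rat]_d.+1 * nat) : set E :=
  box (map_mx ratr q.1 - const_mx q.2.+1%:R^-1, map_mx ratr q.1 + const_mx q.2.+1%:R^-1).
have -> : U = \bigcup_q (if `[< C q `<=` U >] then C q else set0).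
  apply/seteqP; split => [x Ux|x [q _]]; last by case: asboolP => // CU /CU.
  have /nbhs_ballP[e /= e0 xU] : nbhs x U by exact: open_nbhs_nbhs.
  (* The box around a center q within 1 / (n + 1) of x only contains points
     within 2 / (n + 1) of x. *)
  have [n ne] : exists n : nat, n.+1%:R^-1 < e / 2.
    exists (Num.truncn (e / 2)^-1).
    rewrite invf_plt ?posrE ?divr_gt0//.
    exact: truncnS_gt.
  have [q xq] : exists q : 'rV[rat]_d.+1, forall i,
      x 0 i < ratr (q 0 i) < x 0 i + n.+1%:R^-1.
    have h i : {q : rat | x 0 i < ratr q < x 0 i + n.+1%:R^-1}.
      apply: cid; have [|q] := @rat_in_itvoo R (x 0 i) (x 0 i + n.+1%:R^-1).
        by rewrite ltrDl invr_gt0.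
      by rewrite in_itv /=; exists q.
    exists (\row_i sval (h i)) => i; rewrite mxE; exact: (svalP (h i)).
  have n0 : (0 : R) < n.+1%:R^-1 by rewrite invr_gt0.
  exists (q, n) => //; case: asboolP => [_|].
    by move=> i; rewrite /= !mxE; have := xq i; move: n0; move: (_^-1) => r; lra.
  case=> y yq; apply: xU.
  split => // i j; rewrite ord1 /ball /=; have := xq j; have := yq j.
  rewrite /= !mxE ltr_norml; move: n0 ne; move: (_.+1%:R^-1) => r; lra.
apply: countable_bigcupT_measurable => // q; case: asboolP => // _.
exact: box_measurable.
Qed.

Lemma closed_rV_measurable (C : set E) : closed C -> rV_measurable C.
Proof.
by move=> cC; rewrite -(setCK C); apply/measurableC/open_rV_measurable/closed_openC.
Qed.

Definition cube (r : R) : set E := [set x | forall i, `|x 0 i| <= r].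

Lemma closed_cube r : closed (cube r).
Proof.
have -> : cube r = \bigcap_i [set x : E | `|x 0 i| <= r].
  by apply/seteqP; split => [x xr i _|x xr i]; [exact: xr|exact: (xr i I)].
apply: closed_bigI => i _.
apply: (@closed_comp _ _ (fun x : E => `|x 0 i|) [set y | y <= r]) => [x _|].
  by apply: continuous_comp; [exact: coord_continuous|exact: norm_continuous].
exact: closed_le.
Qed.

Lemma rV_norm_le (x : E) r : (forall i, `|x 0 i| <= r) -> `|x| <= r.
Proof.
move=> xr; rewrite /Num.norm /= mx_normrE; apply/bigmax_leP; split.
  by apply: le_trans (xr 0); exact: normr_ge0.
by move=> [i j] _; rewrite /= ord1.
Qed.

Lemma coord_le_norm (x : E) i : `|x 0 i| <= `|x|.
Proof.
rewrite [leRHS]/Num.norm /= mx_normrE.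
exact: (@le_bigmax _ R _ 0 (fun ij : 'I_1 * 'I_d.+1 => `|x ij.1 ij.2|) (0, i)).
Qed.

Lemma compact_cube r : compact (cube r).
Proof.
apply: bounded_closed_compact; last exact: closed_cube.
exists r; split; first exact: num_real.
by move=> s rs x xr; apply: (le_trans _ (ltW rs)); exact: rV_norm_le.
Qed.

Lemma lebesgue_outer_cube r : (lebesgue_outer (cube r) < +oo)%E.
Proof.
pose ab : E * E := (const_mx (- r - 1), const_mx r).
apply: (@le_lt_trans _ _ (box_volume ab)); last exact: ltry.
have null0 : @box_volume R d (0, 0) = 0%E.
  by rewrite /box_volume big_ord_recl /= subrr maxxx mul0r.
apply: ereal_inf_lbound; exists (fun k => if k == 0 then ab else (0, 0)).
  (* Boxes are open on the left, hence the lower corner - r - 1; the remaining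
     boxes of the cover are empty. *)
  move=> x xr; exists 0%N => // i; have := xr i.
  by rewrite ler_norml !mxE; lra.
rewrite (@nneseries_split _ _ 0 1); last by move=> *; exact: box_volume_ge0.
by rewrite add0n big_nat1 eseries0 ?adde0// => -[].
Qed.

Lemma rV_subr_continuous (v : E) : continuous (fun y : E => y - v).
Proof.
move=> y; apply: (@cvgB _ E _ (nbhs y) _ id (cst v)); last exact: cvg_cst.
exact: cvg_id.
Qed.

(** The translates of A along the i-th axis by distinct amounts are disjoint.
Within a cube, infinitely many of them fit in a slightly larger cube of finite
measure, and the measure of each is at least that of the part of A in the
cube, which is therefore null. *)
Lemma closed_line_null (A : set E) (i : 'I_d.+1) : closed A ->
  (forall p t, A p -> A (p + t *: delta_mx 0 i) -> t = 0) ->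
  lebesgue_outer A = 0%E.
Proof.
move=> cA lineA.
pose A' n := A `&` cube n%:R.
have cA' n : closed (A' n) by apply: closedI => //; exact: closed_cube.
have -> : A = \bigcup_n A' n.
  apply/seteqP; split => [x Ax|x [n _ []]//].
  exists (Num.truncn `|x|).+1 => //; split => // j.
  by rewrite (le_trans (coord_le_norm x j))// ltW// truncnS_gt.
apply/eqP; rewrite eq_le lebesgue_outer_ge0 andbT.
apply: le_trans (lebesgue_outer_sigma_subadditive _) _.
rewrite eseries0// => n _ _.
(* Translating by at most 1 keeps the translates in the cube of size n + 1. *)
pose v k : E := k.+1%:R^-1 *: delta_mx 0 i.
pose T k : set E := [set x | A' n (x - v k)].
have mT k : rV_measurable (T k).
  apply: closed_rV_measurable; apply: closed_comp (cA' n) => x _.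
  exact: rV_subr_continuous.
have trT : trivIset setT T.
  apply/trivIsetP => j k _ _ jk; apply/seteqP; split => // x [[Aj _] [Ak _]].
  have := lineA _ (j.+1%:R^-1 - k.+1%:R^-1) Aj.
  rewrite scalerBl addrA subrK => /(_ Ak)/eqP.
  rewrite subr_eq0 => /eqP/invr_inj/eqP.
  by rewrite eqr_nat eqSS (negbTE jk).
have mTU : rV_measurable (\bigcup_k T k) by exact: bigcupT_measurable.
have : (\sum_(k <oo) mu (T k) < +oo)%E.
  rewrite -(measure_semi_bigcup _ mT trT mTU).
  apply: le_lt_trans (lebesgue_outer_cube (n%:R + 1)).
  apply: le_lebesgue_outer => x [k _ [_ xn]] j; have := xn j.
  rewrite !mxE eqxx /=.
  have : (0 < k.+1%:R^-1 :> R) && (k.+1%:R^-1 <= 1 :> R).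
    by rewrite invr_gt0 ltr0Sn/= invf_le1 ?ler1n.
  move: (k.+1%:R^-1) => r; rewrite !ler_norml; case: (j == i) => /=; lra.
have := le_lebesgue_outer (@subIsetr _ A (cube n%:R)).
move/le_lt_trans => /(_ _ (lebesgue_outer_cube _)).
rewrite -/(A' n) => Afin; move Ec : (lebesgue_outer (A' n)) Afin => c Afin.
have c_ge0 : (0 <= c)%E by rewrite -Ec lebesgue_outer_ge0.
case: c c_ge0 Afin Ec => // c; rewrite lee_fin => c_ge0 _ Ec.
have T_ge0 k : (0 <= mu (T k))%E by exact: lebesgue_outer_ge0.
move ES : (\sum_(k <oo) mu (T k))%E => S Sfin.
have S_ge N : ((c *+ N)%:E <= S)%E.
  rewrite -ES; apply: le_trans (nneseries_lim_ge N _) => //=.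
  have -> : (c *+ N)%:E = (\sum_(0 <= k < N) c%:E)%E.
    by rewrite sumEFin sumr_const_nat subn0.
  by apply: lee_sum => k _; rewrite -Ec; exact: le_lebesgue_outer_shift.
case: S Sfin S_ge {ES} => [s| |] // _ S_ge; last by have := S_ge 0.
apply: contrapT => /eqP; rewrite eqe => c_neq0.
have c_gt0 : 0 < c by rewrite lt_def c_neq0.
have := S_ge (Num.truncn (s / c)).+1.
rewrite lee_fin leNgt -mulr_natr mulrC -ltr_pdivrMr // truncnS_gt //.
Qed.

End lebesgue_sets.

(** * The scalar product *)

Section dot_product.
Context {R : realType} {d : nat}.
Local Notation E := 'rV[R]_d.+1.
Implicit Types (p q x y : E) (t : R).

Lemma dotvDr p x y : dotv p (x + y) = dotv p x + dotv p y.
Proof. by rewrite -big_split; apply: eq_bigr => i _; rewrite mxE mulrDr. Qed.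

Lemma dotvDl p q x : dotv (p + q) x = dotv p x + dotv q x.
Proof. by rewrite -big_split; apply: eq_bigr => i _; rewrite mxE mulrDl. Qed.

Lemma dotvZr p t x : dotv p (t *: x) = t * dotv p x.
Proof. by rewrite mulr_sumr; apply: eq_bigr => i _; rewrite mxE mulrCA. Qed.

Lemma dotvZl p t x : dotv (t *: p) x = t * dotv p x.
Proof. by rewrite mulr_sumr; apply: eq_bigr => i _; rewrite mxE mulrA. Qed.

Lemma dotvBr p x y : dotv p (x - y) = dotv p x - dotv p y.
Proof. by rewrite dotvDr -scaleN1r dotvZr mulN1r. Qed.

Lemma dotvBl p q x : dotv (p - q) x = dotv p x - dotv q x.
Proof. by rewrite dotvDl -scaleN1r dotvZl mulN1r. Qed.

Lemma dotv_deltar p i : dotv p (delta_mx 0 i) = p 0 i.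
Proof.
rewrite /dotv (bigD1 i)//= mxE !eqxx mulr1 big1 ?addr0// => j /negbTE ji.
by rewrite mxE ji andbF mulr0.
Qed.

Lemma dotv_deltal x i : dotv (delta_mx 0 i) x = x 0 i.
Proof.
rewrite /dotv (bigD1 i)//= mxE !eqxx mul1r big1 ?addr0// => j /negbTE ji.
by rewrite mxE ji andbF mul0r.
Qed.

Lemma cvg_dotv (T : Type) (F : set_system T) (FF : Filter F) (f g : T -> E) p x :
  f @ F --> p -> g @ F --> x -> dotv (f t) (g t) @[t --> F] --> dotv p x.
Proof.
move=> fp gx; rewrite /dotv.
apply: (cvg_big (op := +%R)) => [|i _]; first by move=> z; exact: add_continuous.
apply: cvgM.
  exact: (cvg_comp _ _ fp (@coord_continuous R 1 d.+1 0 i p)).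
exact: (cvg_comp _ _ gx (@coord_continuous R 1 d.+1 0 i x)).
Qed.

End dot_product.

(** * Continuity of bounded convex functions *)

Section bounded_convex.
Context {R : realType} {d : nat}.
Local Notation E := 'rV[R]_d.+1.
Context (Om : set E) (u : E -> R) (M : R).
Context (Om_open : open Om).
Context (u_le : forall x, closure Om x -> `|u x| <= M).
Context (u_convex : @convex_function R E (closure Om) u).
Implicit Types (p x y z : E).

Lemma convex_segment_le x y t : closure Om x -> closure Om y -> 0 <= t <= 1 ->
  u (t *: x + (1 - t) *: y) <= t * u x + (1 - t) * u y.
Proof.
move=> Ox Oy /andP[t0 t1].
by have := u_convex (Itv01 t0 t1) (mem_set Ox) (mem_set Oy).
Qed.

Lemma ball_subset_domain x : Om x -> exists2 r : R, 0 < r &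
  forall y, `|y - x| < r -> Om y.
Proof.
move=> Ox; have /nbhs_ballP[r /= r0 xr] : nbhs x Om by exact: open_nbhs_nbhs.
exists r => // y yr; apply: xr; rewrite -ball_normE /ball_ /=.
by rewrite distrC.
Qed.

(** Let y be at distance less than r * s from x, where the ball of radius r around
x lies in the domain.  Then y lies between x and x + (y - x) / s, and x between
y and x - (y - x) / s, all in the domain; convexity on these two segments bounds
u y - u x from above and from below by a multiple of s. *)
Lemma convex_bounded_continuous x : Om x -> {for x, continuous u}.
Proof.
move=> Ox; have [r r0 xr] := ball_subset_domain Ox.
have M0 : 0 <= M by apply: le_trans (u_le (subset_closure Ox)); exact: normr_ge0.
have u_leM y : Om y -> `|u y| <= M by move=> /subset_closure/u_le.
have key y (s : R) : 0 < s <= 1 -> `|y - x| < r * s -> `|u x - u y| <= 2 * M * s.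
  move=> /andP[s0 s1] ys.
  have Oz (e : R) : `|e| = 1 -> Om (x + (e / s) *: (y - x)).
    move=> e1; apply: xr; rewrite addrC addKr normrZ normrM e1 mul1r.
    by rewrite gtr0_norm ?invr_gt0// mulrC ltr_pdivrMr.
  have Oy : Om y by apply: xr; apply: lt_le_trans ys _; rewrite ler_piMr// ltW.
  have := @convex_segment_le _ _ s (subset_closure (Oz 1 (normr1 _))) (subset_closure Ox).
  have -> : s *: (x + (1 / s) *: (y - x)) + (1 - s) *: x = y.
    rewrite scalerDr scalerA mulrC mul1r mulVf ?gt_eqF// scale1r addrAC -scalerDl.
    by rewrite [s + _]addrC subrK scale1r addrC subrK.
  rewrite (ltW s0) s1 => /(_ isT) h1.
  have N1 : `|-1 : R| = 1 by rewrite normrN normr1.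
  have S0 : 1 + s != 0 by rewrite gt_eqF// addr_gt0.
  have := @convex_segment_le _ _ (1 + s)^-1 (subset_closure Oy)
    (subset_closure (Oz _ N1)).
  have -> : (1 + s)^-1 *: y +
      (1 - (1 + s)^-1) *: (x + (-1 / s) *: (y - x)) = x.
    apply/rowP => i; rewrite !mxE; field.
    by rewrite S0 gt_eqF.
  have S1 : 0 <= (1 + s)^-1 <= 1.
    by rewrite invr_ge0 invf_le1 ?ler_wpDr ?addr_ge0 ?addr_gt0 // ltW.
  move=> /(_ S1); rewrite -(ler_pM2l (addr_gt0 ltr01 s0)) mulrDr mulrA divff//.
  rewrite mulrA mulrBr divff// mulr1 mul1r addrAC subrr add0r => h2.
  have scale_le a : `|a| <= M -> s * (a - u x) <= 2 * M * s.
    move=> aM; rewrite mulrC ler_pM2r//; have := u_leM _ Ox.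
    by move: aM; rewrite !ler_norml; lra.
  have := scale_le _ (u_leM _ (Oz _ N1)).
  have := scale_le _ (u_leM _ (Oz _ (normr1 _))).
  rewrite !mulrBr ler_norml; move: h1 h2.
  lra.
apply/(@cvgrPdist_le _ _ _ (nbhs x)) => e e0.
pose s := Num.min 1 (e / (2 * M + 1)).
have MM : 0 < 2 * M + 1 by lra.
have s0 : 0 < s by rewrite lt_min ltr01 divr_gt0.
have s1 : s <= 1 by rewrite ge_min lexx.
have se : 2 * M * s <= e.
  have : s <= e / (2 * M + 1) by rewrite ge_min lexx orbT.
  by rewrite ler_pdivlMr//; nra.
near=> y; apply: le_trans (key y s _ _) se; first by rewrite s0.
rewrite distrC; near: y.
apply: (@cvgr_dist_lt _ _ _ (nbhs x)); [exact: cvg_id|exact: mulr_gt0].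
Unshelve. all: by end_near. Qed.

End bounded_convex.

(** * Measurability of the slopes over a set *)

Section subdifferential_topology.
Context {R : realType} {d : nat}.
Local Notation E := 'rV[R]_d.+1.
Local Notation rV_measurable := (measurable : set (set (@lebesgue_rV R d))).
Context (Om : set E) (u : E -> R).
Context (u_cont : forall x, Om x -> {for x, continuous u}).
Implicit Types (p x y z : E).

(** The relation between slopes and contact points is closed because u is
continuous, and projecting a closed relation along a compact set gives a closed
set.  Pairs of contact points are allowed in order to treat slopes with two
contact points as well. *)
Lemma closed_common_subgradients (T : set (E * E)) : compact T ->
  (forall xy, T xy -> Om xy.1 /\ Om xy.2) ->
  closed [set p | exists2 xy, T xy &
    subdifferential Om u xy.1 p /\ subdifferential Om u xy.2 p].
Proof.
move=> cT TOm; rewrite -openC openE => p notp.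
have far (f : E * E -> E) (xy : E * E) : {for xy, continuous f} ->
    Om (f xy) -> ~ subdifferential Om u (f xy) p ->
    \forall xy' \near xy & p' \near p, ~ subdifferential Om u (f xy') p'.
  move=> fxy Ox /existsNP[z /not_implyP[Oz /negP]]; rewrite -ltNge => lt.
  have f1 : f t.1 @[t --> (nbhs xy, nbhs p)] --> f xy.
    by apply: (@cvg_comp _ _ _ fst f _ (nbhs xy)); [exact: cvg_fst|exact: fxy].
  have lim : (u (f t.1) + dotv t.2 (z - f t.1)) @[t --> (nbhs xy, nbhs p)] -->
      u (f xy) + dotv p (z - f xy).
    apply: cvgD; first exact: (cvg_comp _ _ f1 (u_cont Ox)).
    apply: cvg_dotv; first exact: cvg_snd.
    by apply: (@cvgB _ E _ _ _ (cst z)) => //; exact: cvg_cst.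
  have : \forall t \near (nbhs xy, nbhs p), u z < u (f t.1) + dotv t.2 (z - f t.1).
    exact: (cvgr_gt _ lim _ lt).
  by apply: filterS => -[xy' p'] /= lt' /(_ z Oz); rewrite leNgt lt'.
have : \forall p' \near p, T `<=` [set xy | ~ (subdifferential Om u xy.1 p' /\
     subdifferential Om u xy.2 p')].
  apply: ((compact_near_coveringP T).1 cT _ (nbhs p) (fun p' xy =>
    ~ (subdifferential Om u xy.1 p' /\ subdifferential Om u xy.2 p'))) => xy Txy.
  have [Ox Oy] := TOm _ Txy.
  have [xp|xp] := pselect (subdifferential Om u xy.1 p).
    have yp : ~ subdifferential Om u xy.2 p by move=> yp; apply: notp; exists xy.
    by apply: filterS (far snd xy _ Oy yp) => [[xy' p'] /= H []//|]; exact: cvg_snd.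
  by apply: filterS (far fst xy _ Ox xp) => [[xy' p'] /= H []//|]; exact: cvg_fst.
by apply: filterS => p' H [xy /H].
Qed.

Lemma subdifferential_compact_measurable (K : set E) : compact K -> K `<=` Om ->
  rV_measurable (\bigcup_(x in K) subdifferential Om u x).
Proof.
move=> cK KOm; apply: closed_rV_measurable.
have -> : \bigcup_(x in K) subdifferential Om u x = [set p | exists2 xy,
    [set (x, x) | x in K] xy &
    subdifferential Om u xy.1 p /\ subdifferential Om u xy.2 p].
  apply/seteqP; split => [p [x Kx xp]|p [_ [x Kx <-] [xp _]]]; last by exists x.
  by exists (x, x) => //; exists x.
apply: closed_common_subgradients; last by move=> _ [x Kx <-]; split; exact: KOm.
apply: continuous_compact cK; apply: continuous_subspaceT => x.
exact: (@cvg_pair E E E (nbhs x) (nbhs x) (nbhs x) _ _ _ id id cvg_id cvg_id).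
Qed.

(** K n gathers the points of the cube of size n whose distance to the complement
of U is at least 1 / (n + 1). *)
Lemma open_compact_exhaustion (U : set E) : open U ->
  exists2 K : nat -> set E, (forall n, compact (K n)) & U = \bigcup_n K n.
Proof.
move=> oU; exists (fun n => cube n%:R `&`
    \bigcap_(y in ~` U) [set x | n.+1%:R^-1 <= `|x - y|]) => [n|].
  apply: compact_closedI; first exact: compact_cube.
  apply: closed_bigI => y _.
  apply: (@closed_comp _ _ (fun x : E => `|x - y|) [set r | n.+1%:R^-1 <= r]).
    move=> x _; apply: continuous_comp; last exact: norm_continuous.
    exact: rV_subr_continuous.
  exact: closed_ge.
apply/seteqP; split => [x Ux|x [n _ [_ Kx]]]; last first.
  apply: contrapT => nUx; have := Kx _ nUx; rewrite /= subrr normr0 leNgt.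
  by rewrite invr_gt0 ltr0Sn.
have [r r0 xr] := ball_subset_domain oU Ux.
exists (Num.truncn (`|x| + r^-1)).+1 => //; split.
  move=> i; apply: (le_trans (coord_le_norm x i)); apply/ltW.
  apply: le_lt_trans (truncnS_gt _); by rewrite lerDl invr_ge0 ltW.
move=> y nUy /=; rewrite leNgt; apply/negP => xy; apply: nUy; apply: xr.
rewrite distrC; apply: lt_le_trans xy _; rewrite invf_ple ?posrE ?ltr0Sn//.
apply/ltW; apply: lt_trans (_ : (Num.truncn (`|x| + r^-1)).+1%:R < _); last first.
  by rewrite ltr_nat.
by apply: le_lt_trans (truncnS_gt _); rewrite lerDr.
Qed.

Lemma subdifferential_closed_measurable (U C : set E) : open U -> closed C ->
  U `<=` Om -> rV_measurable (\bigcup_(x in U `&` C) subdifferential Om u x).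
Proof.
move=> oU cC UOm; have [K cK UK] := open_compact_exhaustion oU.
have -> : U `&` C = \bigcup_n (K n `&` C) by rewrite UK setI_bigcupl.
rewrite bigcup_bigcup; apply: bigcupT_measurable => n.
apply: subdifferential_compact_measurable; first exact: compact_closedI.
by move=> x [Kx _]; apply: UOm; rewrite UK; exists n.
Qed.

End subdifferential_topology.

(** * Uniqueness of the contact point *)

Section subdifferential_uniqueness.
Context {R : realType} {d : nat}.
Local Notation E := 'rV[R]_d.+1.
Context (Om : set E) (u : E -> R).
Context (Om_open : open Om).
Context (u_cont : forall x, Om x -> {for x, continuous u}).
Implicit Types (p x y z : E).

Lemma subdifferential_monotone x y p q : Om x -> Om y ->
  subdifferential Om u x p -> subdifferential Om u y q ->
  0 <= dotv (p - q) (x - y).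
Proof.
move=> Ox Oy /(_ _ Oy) + /(_ _ Ox).
by rewrite dotvBl !dotvBr; lra.
Qed.

Definition nonunique_subgradients : set E := [set p | exists x y,
  [/\ Om x, Om y, x != y, subdifferential Om u x p & subdifferential Om u y p]].

(** If x and y are two contact points, then some coordinate satisfies, up to
exchanging x and y, x_i <= a < b <= y_i for rational numbers a and b.  Two
slopes p and p + t e_i with such pairs of contact points, (x, y) and (x', y'),
coincide: monotonicity gives t (x'_i - y_i) >= 0 and t (y'_i - x_i) >= 0, where
the first factor in brackets is negative and the second one positive. *)
Lemma nonunique_subgradients_null : lebesgue_outer nonunique_subgradients = 0%E.
Proof.
have [K cK OmK] := open_compact_exhaustion Om_open.
have KOm n : K n `<=` Om by rewrite OmK => x Kx; exists n.
pose T (w : 'I_d.+1 * (rat * rat) * (nat * nat)) : set (E * E) :=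
  (K w.2.1 `*` K w.2.2) `&` [set xy : E * E | xy.1 0 w.1.1 <= ratr w.1.2.1] `&`
  [set xy : E * E | ratr w.1.2.2 <= xy.2 0 w.1.1].
pose A w := [set p | exists2 xy, T w xy &
    subdifferential Om u xy.1 p /\ subdifferential Om u xy.2 p].
have TOm w xy : T w xy -> Om xy.1 /\ Om xy.2.
  by case=> -[[/= /KOm ? /KOm]].
have cT w : compact (T w).
  apply: compact_closedI; first apply: compact_closedI; first exact: compact_setX.
    apply: (@closed_comp _ _ (fun xy : E * E => xy.1 0 w.1.1) [set y | y <= _]).
      move=> xy _; apply: (@continuous_comp _ _ _ fst (fun x : E => x 0 w.1.1)).
        exact: cvg_fst.
      exact: coord_continuous.
    exact: closed_le.
  apply: (@closed_comp _ _ (fun xy : E * E => xy.2 0 w.1.1) [set y | _ <= y]).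
    move=> xy _; apply: (@continuous_comp _ _ _ snd (fun x : E => x 0 w.1.1)).
      exact: cvg_snd.
    exact: coord_continuous.
  exact: closed_ge.
(* A w is closed and meets the lines parallel to the i-th axis at most once. *)
have Anull w : w.1.2.1 < w.1.2.2 -> lebesgue_outer (A w) = 0%E.
  case: w => [[i [a b]] nn] /= ab.
  have {ab}ab : ratr a < ratr b :> R by rewrite ltr_rat.
  apply: (@closed_line_null _ _ _ i).
    by apply: closed_common_subgradients => // xy; exact: TOm.
  move=> p t [[x y] Txy /= [xp yp]] [[x' y'] Txy' /= [xp' yp']].
  have [/= Ox Oy] := TOm _ _ Txy; have [/= Ox' Oy'] := TOm _ _ Txy'.
  have := subdifferential_monotone Ox' Oy xp' yp.
  have := subdifferential_monotone Oy' Ox yp' xp.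
  rewrite addrC addKr !dotvZl !dotv_deltal !mxE.
  case: Txy => -[_ /= xa] /= yb; case: Txy' => -[_ /= xa'] /= yb'.
  have : 0 < y' 0 i - x 0 i by lra.
  have : x' 0 i - y 0 i < 0 by lra.
  move=> h1 h2; rewrite pmulr_lge0// nmulr_lge0// => ? ?; lra.
pose F k := if @unpickle ('I_d.+1 * (rat * rat) * (nat * nat))%type k is Some w
  then (if w.1.2.1 < w.1.2.2 then A w else set0) else set0.
apply/eqP; rewrite eq_le lebesgue_outer_ge0 andbT.
apply: (@le_trans _ _ (lebesgue_outer (\bigcup_k F k))).
  have sep x y p : Om x -> Om y -> subdifferential Om u x p ->
      subdifferential Om u y p -> forall i, x 0 i < y 0 i -> exists k, F k p.
    move=> Ox Oy xp yp i xy.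
    have [a] := rat_in_itvoo xy; rewrite in_itv /= => /andP[xa ay].
    have [b] := rat_in_itvoo ay; rewrite in_itv /= => /andP[ab ry].
    move: (Ox) (Oy); rewrite OmK => -[n _ Kx] [m _ Ky].
    exists (pickle ((i, (a, b)), (n, m))).
    rewrite /F pickleK /= -(@ltr_rat R) ab; exists (x, y) => //.
    by split; [split => //=|] => /=; exact/ltW.
  apply: le_lebesgue_outer => p [x [y [Ox Oy xy xp yp]]].
  have [i] : exists i, x 0 i != y 0 i.
    apply/existsP; apply: contraNT xy => /existsPn xy; apply/eqP/rowP => i.
    by have := xy i; rewrite negbK => /eqP.
  rewrite neq_lt => /orP[] /sep h.
    by have [k Fk] := h p Ox Oy xp yp; exists k.
  by have [k Fk] := h p Oy Ox yp xp; exists k.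
apply: le_trans (lebesgue_outer_sigma_subadditive _) _.
rewrite eseries0// => k _ _; rewrite /F; case: unpickle => [w|]; last first.
  exact: lebesgue_outer0.
by case: ifPn => [/Anull//|_]; exact: lebesgue_outer0.
Qed.

Context (u_convex : @convex_function R E (closure Om) u).

(** The gap between u and its supporting plane at x is continuous and positive on
the sphere of radius r, where a zero would be another contact point, hence bounded
below there by some eta.  A point y farther away is joined to x by a segment crossing the sphere, and by convexity the gap at
y is at least the gap at the crossing.  The crossing is inside Om, so this holds
up to the boundary, where u may be discontinuous. *)
Lemma unique_subgradient_growth x p (r : R) : Om x -> subdifferential Om u x p ->
  (forall y, Om y -> subdifferential Om u y p -> y = x) ->
  0 < r -> (forall y, `|y - x| <= r -> Om y) ->
  exists2 eta : R, 0 < eta & forall y, closure Om y -> r <= `|y - x| ->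
    u x + dotv p (y - x) + eta <= u y.
Proof.
move=> Ox xp uniq r0 xr.
pose S : set E := [set y | `|y - x| = r].
have S_Om y : S y -> Om y by move=> Sy; apply: xr; rewrite Sy.
pose c y := r / `|y - x|.
pose w y := c y *: y + (1 - c y) *: x.
have wx y : w y - x = c y *: (y - x).
  by apply/rowP => i; rewrite !mxE; ring.
have Sw y : r <= `|y - x| -> S (w y).
  move=> ry; rewrite /S /= wx normrZ.
  by rewrite ger0_norm ?divr_ge0// ?divfK ?gt_eqF ?(lt_le_trans r0) // ltW.
have [S0|/set0P S0] := eqVneq S set0.
  by exists 1 => // y _ /Sw; rewrite S0.
have cS : compact S.
  apply: bounded_closed_compact.
    exists (r + `|x|); split; first exact: num_real.
    move=> s rs y Sy; apply: le_trans (ltW rs).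
    by rewrite -Sy; apply: le_trans (ler_normD _ _); rewrite subrK.
  apply: (@closed_comp _ _ (fun y : E => `|y - x|) [set s | s = r]).
    move=> y _; apply: continuous_comp; last exact: norm_continuous.
    exact: rV_subr_continuous.
  exact: closed_eq.
pose g y := u y - dotv p (y - x).
have cg : {within S, continuous g}.
  apply: continuous_in_subspaceT => y; rewrite inE => Sy.
  apply: (@cvgB _ _ _ (nbhs y) _ u); first exact: (u_cont (S_Om _ Sy)).
  by apply: cvg_dotv; [exact: cvg_cst|exact: rV_subr_continuous].
have [z /set_mem Sz gz] := EVT_min_rV S0 cS cg.
have gzx : u x < g z.
  rewrite ltNge; apply/negP => gzx.
  have zx : z = x.
    apply: uniq; first exact: S_Om.
    move=> y Oy; apply: le_trans (xp y Oy).
    by move: gzx; rewrite /g !dotvBr; lra.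
  by move: Sz; rewrite /S /= zx subrr normr0 => /esym/eqP; rewrite gt_eqF.
exists (g z - u x) => [|y Oy ry]; first by rewrite subr_gt0.
have xy0 : 0 < `|y - x| by exact: lt_le_trans ry.
have c0 : 0 < c y by rewrite divr_gt0.
have c1 : c y <= 1 by rewrite ler_pdivrMr// mul1r.
have := convex_segment_le u_convex Oy (subset_closure Ox) (t := c y).
rewrite -/(w y) (ltW c0) c1 => /(_ isT) conv.
have := gz _ (mem_set (Sw _ ry)).
rewrite {2}/g wx dotvZr => gw.
have : g z - u x <= c y * (u y - u x - dotv p (y - x)) by lra.
nra.
Qed.

End subdifferential_uniqueness.

(** * Lattice points *)

Lemma finite_set_argmin (R : realType) (T : choiceType) (A : set T) (f : T -> R) :
  finite_set A -> A !=set0 -> exists2 a, A a & forall b, A b -> f a <= f b.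
Proof.
move=> /finite_seqP[s ->]; elim: s => [[]//|a s IH _].
have [->|[b sb bmin]] : s = [::] \/ exists2 b, b \in s & forall c, c \in s -> f b <= f c.
- case: s IH => [|c s] IH; [by left|right].
  by have [|b sb bmin] := IH; [exists c; exact: mem_head|exists b].
- by exists a => [|b] /=; rewrite inE// => /eqP ->.
have [ab|ba] := leP (f a) (f b).
  exists a => [|c] /=; rewrite inE ?eqxx// => /orP[/eqP ->//|/bmin].
  exact: le_trans.
exists b => [|c] /=; rewrite inE ?sb ?orbT// => /orP[/eqP ->|/bmin//].
exact: ltW.
Qed.

Section lattice.
Context {R : realType} {d : nat}.
Local Notation E := 'rV[R]_d.+1.
Context (h : R) (h0 : 0 < h).

Lemma lattice_near (x : E) : exists2 y : E, lattice h y & `|y - x| <= h.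
Proof.
exists (h *: of_int (\row_i Num.floor (x 0 i / h))); first by eexists.
apply: rV_norm_le => i; rewrite !mxE.
have := floor_itv (x 0 i / h).
rewrite intrD ler_pdivlMr// ltr_pdivrMr// mulrDl mul1r ler_norml [h * _]mulrC.
by move=> /andP[? ?]; apply/andP; split; lra.
Qed.

Lemma lattice_finite (A : set E) (M : R) :
  (forall x, A x -> `|x| <= M) -> finite_set (A `&` lattice h).
Proof.
move=> AM; pose N := Num.truncn (M / h).
pose g (k : 'rV['I_(N + N).+1]_d.+1) : E :=
  h *: of_int (\row_i ((k 0 i : nat)%:Z - N%:Z)).
apply: (@sub_finite_set _ _ (range g)); last first.
  by apply: finite_image; exact: finite_finset.
move=> x [Ax [m _ mx]]; have := AM _ Ax; rewrite -{x}mx in Ax * => mM.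
have mN i : (absz (m 0%R i) <= N)%N.
  have : h * `|(m 0 i)%:~R| <= M.
    apply: le_trans mM; apply: le_trans (coord_le_norm _ i).
    by rewrite !mxE normrM gtr0_norm.
  rewrite mulrC -ler_pdivlMr// => mMh.
  rewrite /N truncn_ge_nat; last by apply: le_trans mMh.
  by rewrite natr_absz intr_norm.
exists (\row_i inord (absz (m 0 i + N%:Z))) => //; congr (_ *: of_int _).
apply/rowP => i; rewrite !mxE inordK; have := mN i; move: (m 0 i) => a; lia.
Qed.

End lattice.

(** * Convergence of the discrete contact points *)

Section discrete_subdifferential.
Context {R : realType} {d : nat}.
Local Notation E := 'rV[R]_d.+1.
Context (Om : set E) (V : set 'rV[int]_d.+1) (u : E -> R) (M : R).
Context (Om_open : open Om).
Context (Om_le : forall x, Om x -> `|x| <= M).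
Implicit Types (p x y z : E) (h r : R).

Lemma mesh_closure h x : mesh Om V h x -> closure Om x.
Proof. by case=> [[Ox _]|[[]//]]; exact: subset_closure. Qed.

Lemma mesh_in_domain h x : mesh Om V h x -> Om x -> mesh_interior Om h x.
Proof.
case=> // -[[_ nOx] _] Ox; exfalso; apply: nOx.
by move: Om_open; rewrite openE; exact.
Qed.

(** The gap of v above the plane of slope p through (x, u x) is less than eta / 2
at the lattice point y0 and more than eta / 2 at all the mesh points that are far
from x.  A minimum over the finitely many lattice points near x is thus a minimum
over the whole mesh, which may be infinite at the boundary, and all the minima
are near x. *)
Lemma discrete_subgradient_localized h (v : E -> R) x p r eta :
  0 < h -> (forall y, `|y - x| < r -> Om y) ->
  (forall y, closure Om y -> r <= `|y - x| ->
    u x + dotv p (y - x) + eta <= u y) ->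
  (forall y, mesh Om V h y -> `|v y - u y| < eta / 4) ->
  (exists y, [/\ lattice h y, `|y - x| < r &
    u y - dotv p (y - x) < u x + eta / 4]) ->
  (exists y, [/\ Om y, lattice h y, `|y - x| < r &
    mesh_subdifferential Om V h v y p]) /\
  (forall y, mesh Om V h y -> mesh_subdifferential Om V h v y p -> `|y - x| < r).
Proof.
move=> h0 xr growth vu [y0 [Ly0 y0r uy0]].
have mesh_near y : lattice h y -> `|y - x| < r -> mesh Om V h y.
  by move=> Ly /xr Oy; left.
have vy0 : v y0 - dotv p (y0 - x) < u x + eta / 2.
  by have := vu _ (mesh_near _ Ly0 y0r); rewrite ltr_norml; lra.
have far y : mesh Om V h y -> r <= `|y - x| ->
    u x + eta / 2 < v y - dotv p (y - x).
  move=> my ry; have := growth _ (mesh_closure my) ry.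
  by have := vu _ my; rewrite ltr_norml; lra.
split=> [|y my yp]; last first.
  rewrite ltNge; apply/negP => /(far _ my).
  by have := yp _ (mesh_near _ Ly0 y0r); move: vy0; rewrite !dotvBr; lra.
pose near_x := [set y | `|y - x| < r] `&` lattice h.
have [||y [yr Ly] ymin] := @finite_set_argmin R _ near_x
  (fun y => v y - dotv p (y - x)).
- by apply: lattice_finite => // y /xr; exact: Om_le.
- by exists y0.
exists y; split=> //; first exact: xr.
move=> z mz; have [zr|rz] := ltP `|z - x| r.
  have [_ Lz] := mesh_in_domain mz (xr _ zr).
  by have := ymin z (conj zr Lz); rewrite !dotvBr; lra.
have := far _ mz rz; have := ymin _ (conj y0r Ly0).
by move: vy0; rewrite !dotvBr; lra.
Qed.

End discrete_subdifferential.

Section mesh_convergence.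
Context {R : realType} {d : nat}.
Local Notation E := 'rV[R]_d.+1.
Context (Om : set E) (V : set 'rV[int]_d.+1) (u : E -> R).
Context (uh : R -> E -> R) (M : R).
Context (Om_open : open Om).
Context (Om_le : forall x, Om x -> `|x| <= M).
Context (u_convex : @convex_function R E (closure Om) u).
Context (u_le : forall x, closure Om x -> `|u x| <= M).
Context (uh_cvg : mesh_uniform_cvg Om V uh u).
Context (hs : nat -> R) (hs0 : forall k, 0 < hs k) (hs_cvg : hs @ \oo --> (0 : R)).
Implicit Types (p x y z : E) (r : R) (B : set E).

Let u_cont x : Om x -> {for x, continuous u}.
Proof. exact: (convex_bounded_continuous Om_open u_le u_convex). Qed.

Lemma step_small e : 0 < e -> \forall k \near \oo, hs k < e.
Proof. by move=> e0; exact: (cvgr_lt _ hs_cvg). Qed.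

Lemma mesh_error_small e : 0 < e ->
  \forall k \near \oo, forall x, mesh Om V (hs k) x -> `|uh (hs k) x - u x| < e.
Proof.
move=> e0; have [h1 h10 H] := uh_cvg hs_cvg e0.
by apply: filterS (step_small h10) => k hk; apply: H; rewrite hs0.
Qed.

Lemma discrete_subgradient_cvg x p (r : R) : Om x -> subdifferential Om u x p ->
  (forall y, Om y -> subdifferential Om u y p -> y = x) -> 0 < r ->
  \forall k \near \oo,
    (exists y, [/\ Om y, lattice (hs k) y, `|y - x| < r &
      mesh_subdifferential Om V (hs k) (uh (hs k)) y p]) /\
    (forall y, mesh Om V (hs k) y ->
      mesh_subdifferential Om V (hs k) (uh (hs k)) y p -> `|y - x| < r).
Proof.
move=> Ox xp uniq r0; have [r1 r10 xr1] := ball_subset_domain Om_open Ox.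
pose s := Num.min r (r1 / 2).
have s0 : 0 < s by rewrite lt_min r0 divr_gt0.
have sr : s <= r by rewrite ge_min lexx.
have xs y : `|y - x| <= s -> Om y.
  move=> ys; apply: xr1; apply: (le_lt_trans ys).
  by rewrite gt_min ltr_pdivrMr// ltr_pMr// ltr1n orbT.
have [eta eta0 growth] := unique_subgradient_growth u_cont u_convex Ox xp uniq s0 xs.
have : \forall y \near x, u y - dotv p (y - x) < u x + eta / 4.
  have lim : u y - dotv p (y - x) @[y --> x] --> u x - dotv p (x - x).
    apply: (@cvgB _ _ _ (nbhs x) _ u); first exact: u_cont.
    by apply: cvg_dotv; [exact: cvg_cst|exact: rV_subr_continuous].
  apply: (cvgr_lt _ lim).
  by rewrite dotvBr subrr subr0 ltrDl divr_gt0.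
move=> /nbhs_ballP[delta /= delta0 xdelta].
have eta4 : 0 < eta / 4 by rewrite divr_gt0.
have hs1 := step_small delta0; have hs2 := step_small s0.
have err := mesh_error_small eta4.
near=> k.
have [||||near_p far_p] := @discrete_subgradient_localized _ _ Om V u M Om_open
  Om_le (hs k) (uh (hs k)) x p s eta (hs0 k).
- by move=> y /ltW; exact: xs.
- exact: growth.
- by near: k; exact: err.
- have [y Ly yx] := lattice_near (hs0 k) x.
  exists y; split => //.
    by apply: le_lt_trans yx _; near: k; exact: hs2.
  apply: xdelta; rewrite -ball_normE /ball_ /= distrC.
  by apply: le_lt_trans yx _; near: k; exact: hs1.
split; last by move=> y my /(far_p _ my)/lt_le_trans; exact.
by have [y [Oy Ly ys yp]] := near_p; exists y; split => //; exact: lt_le_trans sr.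
Unshelve. all: by end_near. Qed.

(** The contact points of p with u_h eventually stay in any given neighborhood of
the contact point of p with u, and this neighborhood can be chosen inside B or
outside of B, unless that point is on the frontier of B. *)
Lemma discrete_slopes_eventually_eq B p : B `<=` Om ->
  (\bigcup_(x in Om) subdifferential Om u x) p ->
  ~ nonunique_subgradients Om u p ->
  ~ (\bigcup_(x in Om `&` frontier B) subdifferential Om u x) p ->
  \forall k \near \oo,
    (\bigcup_(x in B `&` lattice (hs k))
      mesh_subdifferential Om V (hs k) (uh (hs k)) x) p <->
    (\bigcup_(x in B) subdifferential Om u x) p.
Proof.
move=> BOm [x Ox xp] uniq nfr.
have {}uniq y : Om y -> subdifferential Om u y p -> y = x.
  move=> Oy yp; apply/eqP; apply: contrapT => /negP yx.
  by apply: uniq; exists y, x.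
have [xB|xB] := pselect (interior B x).
  have [r r0 xr] := ball_subset_domain (@open_interior _ B) xB.
  apply: filterS (discrete_subgradient_cvg Ox xp uniq r0) => k [[y [Oy Ly yx yp]] _].
  split=> _; first by exists x => //; exact: interior_subset xB.
  by exists y => //; split => //; apply: interior_subset; exact: xr.
have nclB : (~` closure B) x.
  by move=> clB; apply: nfr; exists x.
have [r r0 xr] := ball_subset_domain (closed_openC (@closed_closure _ B)) nclB.
apply: filterS (discrete_subgradient_cvg Ox xp uniq r0) => k [_ far].
split=> [[y [By Ly] yp]|[y By yp]].
  have /far/(_ yp) /xr : mesh Om V (hs k) y by left; split => //; exact: BOm.
  by case; exact: subset_closure.
case: nclB; rewrite -(uniq _ (BOm _ By) yp); exact: subset_closure.
Qed.

(** The closure of B is compact, so that the translates of B by vectors of norm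
less than some delta stay in Om.  From a lattice point of B one reaches another
point of the mesh by moving along an axis by a distance t between delta / 2 and
delta; each coordinate of a discrete slope is then bounded by the variation of
u_h, which is at most 2 M + 2, divided by delta / 2. *)
Lemma mesh_subdifferential_bounded B : B `<=` Om -> frontier B `<=` Om ->
  exists C : R, \forall k \near \oo,
    \bigcup_(x in B `&` lattice (hs k))
      mesh_subdifferential Om V (hs k) (uh (hs k)) x `<=` cube C.
Proof.
move=> BOm frOm.
have clB : closure B `<=` Om.
  move=> x clx; have [/interior_subset/BOm//|nx] := pselect (interior B x).
  by apply: frOm.
have cclB : compact (closure B).
  apply: bounded_closed_compact; last exact: closed_closure.
  exists M; split; first exact: num_real.
  by move=> s Ms x /clB/Om_le/le_trans; apply; exact: ltW.
have : \forall v \near (0 : E), closure B `<=` [set x | Om (x + v)].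
  apply: ((compact_near_coveringP (closure B)).1 cclB _ (nbhs (0 : E))
    (fun v x => Om (x + v))) => x /clB Ox.
  have : nbhs (x + 0) Om by rewrite addr0; exact: open_nbhs_nbhs.
  have : (fun z : E * E => z.1 + z.2) @ nbhs ((x : E), (0 : E)) --> (x : E) + 0.
    by apply: cvgD; [exact: cvg_fst|exact: cvg_snd].
  by move=> /[apply]; apply: filterS => -[].
move=> /nbhs_ballP[delta /= delta0 Bdelta].
exists ((2 * M + 2) / (delta / 2)).
have d20 : 0 < delta / 2 by rewrite divr_gt0.
near=> k => p [x [Bx [m _ mx]] xp] i.
have hd : hs k < delta / 2 by near: k; exact: step_small.
have err : forall x, mesh Om V (hs k) x -> `|uh (hs k) x - u x| < 1.
  by near: k; exact: mesh_error_small.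
pose n := (Num.truncn (delta / 2 / hs k)).+1.
pose t := n%:R * hs k.
have t_gt : delta / 2 < t.
  by rewrite -ltr_pdivrMr//; exact: truncnS_gt.
have t_lt : t < delta.
  have : (Num.truncn (delta / 2 / hs k))%:R <= delta / 2 / hs k.
    by rewrite truncn_le divr_ge0// ltW.
  rewrite ler_pdivlMr// /t /n; move: (Num.truncn _) hd => q hd.
  by rewrite -[q.+1%:R]natr1 mulrDl mul1r; lra.
have t0 : 0 < t by lra.
have step (e : int) : `|e|%N = 1%N ->
    e%:~R * p 0 i * t <= 2 * M + 2.
  move=> e1.
  pose y := x + (e%:~R * t) *: delta_mx 0 i.
  have e1R : `|e%:~R : R| = 1 by rewrite -intr_norm -natr_absz e1.
  have my : mesh Om V (hs k) y.
    left; split.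
      apply: (Bdelta ((e%:~R * t) *: delta_mx 0 i)); last exact: subset_closure.
      rewrite -ball_normE /ball_ /= sub0r normrN normrZ normrM e1R mul1r.
      apply: le_lt_trans t_lt; rewrite (gtr0_norm t0) ler_piMr ?(ltW t0)//.
      apply: rV_norm_le => j; rewrite mxE eqxx /=.
      by case: (j == i); rewrite ?normr1 ?normr0.
    exists (m + (e * n%:Z) *: delta_mx 0 i) => //.
    rewrite /y -mx; apply/rowP => j; rewrite !mxE eqxx /=.
    rewrite rmorphD /= !rmorphM /= /t; case: (j == i) => /=; ring.
  have mx' : mesh Om V (hs k) x.
    by left; split; [exact: BOm|exists m].
  have := xp _ my; have := err _ my; have := err _ mx'.
  have := u_le (mesh_closure my); have := u_le (mesh_closure mx').
  rewrite /y [x + _]addrC addrK dotvZr dotv_deltar mulrAC.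
  rewrite !ltr_norml !ler_norml; lra.
rewrite ler_pdivlMr//.
have := step 1 erefl; have := step (-1) erefl.
rewrite rmorphN rmorph1 mulN1r mul1r mulNr.
have : `|p 0 i| * (delta / 2) <= `|p 0 i| * t by rewrite ler_wpM2l// ltW.
case: (ler0P (p 0 i)); lra.
Unshelve. all: by end_near. Qed.

End mesh_convergence.

(** * Limits of integrals *)

Section integral_convergence.
Local Open Scope ereal_scope.
Context d (T : measurableType d) (R : realType).
Context (mu : {measure set T -> \bar R}).
Implicit Types (f : T -> \bar R) (fs : nat -> T -> \bar R).

Lemma ge0_integral_cvgy fs f : (forall k, measurable_fun setT (fs k)) ->
  measurable_fun setT f -> (forall k x, 0 <= fs k x) -> (forall x, 0 <= f x) ->
  {ae mu, forall x, fs k x @[k --> \oo] --> f x} ->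
  \int[mu]_x f x = +oo -> \int[mu]_x fs k x @[k --> \oo] --> +oo.
Proof.
move=> mfs mf fs0 f0 cvgf intf.
have mlim : measurable_fun setT (fun x => limn_einf (fs ^~ x)).
  under eq_fun do rewrite -[limn_einf _]oppeK -limn_esupN.
  apply: measurableT_comp; first exact: oppe_measurable.
  by apply: measurable_fun_limn_esup => k; exact: measurableT_comp.
have : \int[mu]_x f x <= limn_einf (fun k => \int[mu]_x fs k x).
  rewrite (_ : \int[mu]_x f x = \int[mu]_x limn_einf (fs ^~ x)).
    by apply: fatou.
  apply: ge0_ae_eq_integral => //.
    move=> x _; rewrite limn_einf_lim; apply: lime_ge; first exact: is_cvg_einfs.
    by apply: nearW => k; apply: le_ereal_inf_tmp => _ [n _ <-].
  by apply: filterS cvgf => x cvgx _; rewrite (cvg_limn_einf_sup cvgx).1.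
rewrite intf leye_eq limn_einf_lim => /eqP limy.
apply: (@gee_cvgy _ _ _ _ (einfs (fun k => \int[mu]_x fs k x))).
  by apply: nearW => k; apply: ereal_inf_lbound; exists k => /=.
by rewrite -limy; exact: is_cvg_einfs.
Qed.

Lemma integral_cvg_dominated fs f g : (forall k, measurable_fun setT (fs k)) ->
  measurable_fun setT f -> mu.-integrable setT g ->
  {ae mu, forall x, fs k x @[k --> \oo] --> f x} ->
  (\forall k \near \oo, forall x, `|fs k x| <= g x) ->
  \int[mu]_x fs k x @[k --> \oo] --> \int[mu]_x f x.
Proof.
move=> mfs mf ig cvgf [N _ fg]; rewrite -(cvg_shiftn N).
have [| | | | |_ _ //] // := @dominated_convergence _ _ _ mu setT measurableT
  (fun k => fs (k + N)%N) f g.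
- by apply: filterS cvgf => x cvgx _; rewrite (cvg_shiftn N (fs ^~ x)).
- by apply: aeW => x k _; apply: fg; rewrite /= leq_addl.
Qed.

End integral_convergence.

Section lebesgue_rV_lemmas.
Context {R : realType} {d : nat}.
Local Notation E := 'rV[R]_d.+1.
Local Notation mu := (@lebesgue_measure_rV R d).
Local Notation rV_measurable := (measurable : set (set (@lebesgue_rV R d))).

Lemma null_rV_measurable (A : set E) : lebesgue_outer A = 0%E -> rV_measurable A.
Proof.
move=> A0; apply: le_caratheodory_measurable => X.
rewrite [X in (X + _)%E](_ : _ = 0%E) ?add0e.
  by apply: le_lebesgue_outer => x [].
apply/eqP; rewrite eq_le lebesgue_outer_ge0 andbT -A0.
by apply: le_lebesgue_outer => x [].
Qed.

Lemma null_of_integral_pos (A : set E) (f : E -> R) : rV_measurable A ->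
  measurable_fun [set: lebesgue_rV] (f : lebesgue_rV -> R) ->
  (forall x, A x -> 0 < f x) -> (\int[mu]_(x in A) (f x)%:E = 0)%E ->
  lebesgue_outer A = 0%E.
Proof.
move=> mA mf fpos intf.
have mfA : measurable_fun (A : set lebesgue_rV) (EFin \o f).
  by apply: measurable_funTS; exact/measurable_EFinP.
have /(ae_eq_integral_abs _ mA mfA).1 : (\int[mu]_(x in A) `|(EFin \o f) x| = 0)%E.
  rewrite -[RHS]intf; apply: eq_integral => x /set_mem Ax.
  by rewrite gee0_abs//= lee_fin ltW// fpos.
case=> N [mN N0 AN]; apply/eqP; rewrite eq_le lebesgue_outer_ge0 andbT -N0.
apply: le_lebesgue_outer => x Ax; apply: AN => /(_ Ax) /= [] /eqP.
by rewrite gt_eqF// fpos.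
Qed.

Lemma closed_mesh_subdifferential (Om : set E) V h (v : E -> R) x :
  closed (mesh_subdifferential Om V h v x).
Proof.
have -> : mesh_subdifferential Om V h v x = \bigcap_(y in mesh Om V h)
    [set p | v x + dotv p (y - x) <= v y].
  by apply/seteqP; split => p xp y => [my|]; exact: xp.
apply: closed_bigI => y _.
apply: (@closed_comp _ _ (fun p : E => v x + dotv p (y - x)) [set r | r <= v y]).
  move=> p _; apply: (@cvgD _ _ _ (nbhs p) _ (cst (v x))); first exact: cvg_cst.
  by apply: cvg_dotv; [exact: cvg_id|exact: cvg_cst].
exact: closed_le.
Qed.

End lebesgue_rV_lemmas.

(** * Weak convergence *)

Theorem theorem7 (R : realType) (d : nat)
    (Om : set 'rV[R]_d.+1) (V : set 'rV[int]_d.+1)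
    (u : 'rV[R]_d.+1 -> R) (uh : R -> 'rV[R]_d.+1 -> R)
    (rho : 'rV[R]_d.+1 -> R)
    (Om_nonempty : Om !=set0) (Om_open : open Om)
    (Om_bounded : bounded_set Om)
    (Om_convex : @convex_set R 'rV[R]_d.+1 Om)
    (V_directions : direction_set V)
    (u_bounded : [bounded u x | x in closure Om])
    (u_convex : @convex_function R 'rV[R]_d.+1 (closure Om) u)
    (rho_locint : locally_integrable_rV rho)
    (rho_pos : forall p,
      (\bigcup_(x in Om) subdifferential Om u x) p -> 0 < rho p)
    (rho_zero : forall p,
      ~ (\bigcup_(x in Om) subdifferential Om u x) p -> rho p = 0)
    (uh_cvg : mesh_uniform_cvg Om V uh u) :
  weak_cvg Om (fun h => mesh_omega Om V h rho (uh h)) (omega Om rho u).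
Proof.
have [M [Om_le u_le]] : exists M : R, (forall x, Om x -> `|x| <= M) /\
    (forall x, closure Om x -> `|u x| <= M).
  have : \forall M \near +oo, (forall x, Om x -> `|x| <= M) /\
      (forall x, closure Om x -> `|u x| <= M).
    by apply: filterI; [exact: Om_bounded|exact: u_bounded].
  by move=> /filter_ex.
have u_cont x (Ox : Om x) := convex_bounded_continuous Om_open u_le u_convex Ox.
have [mrho rho_int] := rho_locint.
have mErho : measurable_fun [set: lebesgue_rV] (EFin \o rho : lebesgue_rV -> \bar R).
  exact/measurable_EFinP.
pose dom := \bigcup_(x in Om) subdifferential Om u x.
have rho_ge0 p : 0 <= rho p.
  by have [/rho_pos/ltW//|/rho_zero ->] := pselect (dom p).
move=> hs hs0 hs_cvg B _ BOm frB muB0.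
pose Dk k := \bigcup_(x in B `&` lattice (hs k))
  mesh_subdifferential Om V (hs k) (uh (hs k)) x.
pose D := \bigcup_(x in B) subdifferential Om u x.
pose Z := \bigcup_(x in Om `&` frontier B) subdifferential Om u x.
(* The slopes over the frontier of B have no mass, and rho is positive there. *)
have Z0 : lebesgue_outer Z = 0%E.
  apply: null_of_integral_pos mrho _ muB0; last first.
    by move=> p [x [Ox _] xp]; apply: rho_pos; exists x.
  apply: (subdifferential_closed_measurable u_cont) => //.
  rewrite /frontier setDE; apply: closedI; first exact: closed_closure.
  exact/open_closedC/open_interior.
have mDk k : (measurable : set (set (@lebesgue_rV R d))) (Dk k).
  apply: fin_bigcup_measurable => [|x _].
    by apply: (lattice_finite (hs0 k) (M := M)) => x /BOm/Om_le.
  exact/closed_rV_measurable/closed_mesh_subdifferential.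
(* Up to the null set Z, the slopes over B are those over its interior. *)
have mD : (measurable : set (set (@lebesgue_rV R d))) D.
  have -> : D = \bigcup_(x in interior B `&` setT) subdifferential Om u x `|`
      \bigcup_(x in B `\` interior B) subdifferential Om u x.
    by rewrite setIT -bigcup_setU setDUK //; exact: interior_subset.
  apply: measurableU.
    apply: (subdifferential_closed_measurable u_cont) => //.
    - exact: open_interior.
    - by move=> x /interior_subset/BOm.
  apply: null_rV_measurable; apply/eqP.
  rewrite eq_le lebesgue_outer_ge0 andbT -Z0; apply: le_lebesgue_outer.
  move=> p [x [Bx nBx] xp]; exists x => //; split; first exact: BOm.
  by split => //; exact: subset_closure.
pose fk k := (EFin \o rho) \_ (Dk k); pose f := (EFin \o rho) \_ D.
have restrict_ge0 (A : set 'rV[R]_d.+1) p : (0 <= ((EFin \o rho) \_ A) p)%E.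
  by rewrite patchE; case: ifP => // _; rewrite lee_fin.
have mfk k : measurable_fun [set: lebesgue_rV] (fk k).
  by apply/measurable_restrict => //; rewrite setTI; exact: measurable_funTS.
have mf : measurable_fun [set: lebesgue_rV] f.
  by apply/measurable_restrict => //; rewrite setTI; exact: measurable_funTS.
have fk_cvg : {ae (@lebesgue_measure_rV R d),
    forall p, fk k p @[k --> \oo] --> f p}.
  pose N := nonunique_subgradients Om u.
  have N0 : lebesgue_outer N = 0%E by exact: nonunique_subgradients_null.
  exists (N `|` Z); split.
  - by apply: measurableU; exact: null_rV_measurable.
  - by rewrite measureU0 //; exact: null_rV_measurable.
  move=> p; apply: contraPP => /not_orP[Np Zp]; apply.
  apply: cvg_near_cst.
  have [domp|ndomp] := pselect (dom p); last first.
    apply: nearW => k; rewrite /fk /f !patchE /= rho_zero//.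
    by case: ifP; case: ifP.
  have := discrete_slopes_eventually_eq Om_open Om_le u_convex u_le uh_cvg hs0 hs_cvg
    BOm domp Np Zp.
  apply: filterS => k kp; rewrite /fk /f !patchE.
  suff -> : (p \in Dk k) = (p \in D) by [].
  by apply/idP/idP; rewrite !inE => /kp.
pose mu := @lebesgue_measure_rV R d.
suff : (\int[mu]_p fk k p @[k --> \oo] --> \int[mu]_p f p)%E.
  rewrite /f -integral_mkcond.
  by under eq_fun do rewrite /fk -integral_mkcond.
have omegaB : omega Om rho u B = (\int[mu]_p f p)%E by exact: integral_mkcond.
(* Fatou when the mass of B is infinite; otherwise domination, by rho on a cube
   or by rho alone, according to the mass of Om. *)
have [muBy|muB_fin] := eqVneq (omega Om rho u B) +oo%E.
  rewrite -omegaB muBy.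
  apply: (ge0_integral_cvgy mfk mf) => [k p|p||//]; try exact: restrict_ge0.
    exact: fk_cvg.
  by rewrite -omegaB.
have [muOmy|muOm_fin] := eqVneq (omega Om rho u Om) +oo%E.
  have muBlty : (omega Om rho u B < +oo)%E by rewrite ltey.
  have [C DkC] := mesh_subdifferential_bounded Om_open Om_le u_le uh_cvg hs0
    hs_cvg BOm (frB muOmy muBlty).
  have mC := closed_rV_measurable (@closed_cube R d C).
  have iC : mu.-integrable setT ((EFin \o rho) \_ (cube C)).
    have := (@integrable_mkcond _ _ R mu _ (EFin \o rho) mC).1; apply.
    apply/integrableP; split; first exact: measurable_funTS.
    by have := rho_int _ (@compact_cube R d C).
  apply: (integral_cvg_dominated mfk mf iC fk_cvg).
  apply: filterS DkC => k DkC p; rewrite gee0_abs ?restrict_ge0//.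
  rewrite /fk !patchE; case: ifPn => [/set_mem/DkC/mem_set ->//|_].
  by case: ifP => // _; rewrite lee_fin.
have irho : mu.-integrable setT (EFin \o rho).
  apply/integrableP; split => //.
  rewrite (_ : integral _ _ _ = omega Om rho u Om) ?ltey//.
  rewrite /omega [RHS]integral_mkcond; apply: eq_integral => p _.
  rewrite patchE; case: ifPn => [_|]; first by rewrite gee0_abs// lee_fin.
  by move=> /negP; rewrite inE => /rho_zero /= ->; rewrite normr0.
apply: (integral_cvg_dominated mfk mf irho fk_cvg).
apply: nearW => k p; rewrite gee0_abs ?restrict_ge0// /fk patchE.
by case: ifP => // _; rewrite lee_fin.
Qed.
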